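(* The hyperbolic plane $\mathbb{H}^2$ is $\log 2$-hyperbolic, and this is optimal: if $\delta\ge 0$ is such that $\mathbb{H}^2$ is $\delta$-hyperbolic, then $\delta\ge\log 2$.
   Context: $\mathbb{H}^2$ is the hyperbolic plane of constant curvature $-1$; in the upper half-plane model $\{w\in\mathbb{C}:\mathrm{Im}\, w>0\}$ its distance is given by $\cosh|w_1,w_2|=1+\frac{|w_1-w_2|^2}{2(\mathrm{Im}\, w_1)(\mathrm{Im}\, w_2)}$. A metric space $X$ with distance $|\cdot,\cdot|$ is $\delta$-hyperbolic ($\delta\ge0$), in the sense of Gromov's original definition, if $(x,y)_o\ge\min\{(x,z)_o,(y,z)_o\}-\delta$ for all $x,y,z,o\in X$, where $(x,y)_o=\tfrac12\big(|x,o|+|y,o|-|x,y|\big)$; equivalently, $|x,y|+|z,t|\le\max\{|x,z|+|y,t|,\,|z,y|+|x,t|\}+2\delta$ for all $x,y,z,t\in X$. The logarithm is the natural one. *)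

(* Defs.v *)
From Stdlib Require Import Reals Lra ProofIrrelevance.
From Coquelicot Require Import Coquelicot.
Open Scope R_scope.

(** * Gromov hyperbolicity of a metric space *)

Definition gromov_product (X : Metric_Space) (o x y : Base X) : R :=
  (dist X x o + dist X y o - dist X x y) / 2.

(* The base point [o] ranges over the whole space. *)
Definition gromov_hyperbolic (delta : R) (X : Metric_Space) : Prop :=
  forall x y z o : Base X,
    gromov_product X o x y >=
      Rmin (gromov_product X o x z) (gromov_product X o y z) - delta.

(** * The hyperbolic plane in the upper half-plane model *)

(* Inverse of [cosh : [0, +oo) -> [1, +oo)]; see [cosh_arcosh], [arcosh_ge_0]. *)
Definition arcosh (x : R) : R := ln (x + sqrt (x ^ 2 - 1)).

Record upper_half_plane : Type := UHP {
  uhp_val :> C;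
  uhp_im_pos : 0 < Im uhp_val }.

Definition hdist (w1 w2 : upper_half_plane) : R :=
  arcosh (1 + Cmod (w1 - w2) ^ 2 / (2 * Im w1 * Im w2)).

Lemma arcosh_ge_0 (x : R) : 1 <= x -> 0 <= arcosh x.
Proof.
intros Hx; unfold arcosh; rewrite <- ln_1.
pose proof (sqrt_pos (x ^ 2 - 1)).
apply ln_le; lra.
Qed.

Lemma cosh_arcosh (x : R) : 1 <= x -> cosh (arcosh x) = x.
Proof.
intros Hx; unfold arcosh, cosh.
pose proof (sqrt_pos (x ^ 2 - 1)) as Hp.
assert (Hs : sqrt (x ^ 2 - 1) * sqrt (x ^ 2 - 1) = x ^ 2 - 1)
  by (apply sqrt_sqrt; nra).
rewrite exp_Ropp, exp_ln by lra.
set (s := sqrt (x ^ 2 - 1)) in *.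
replace (/ (x + s)) with (x - s); [lra|].
apply (Rmult_eq_reg_l (x + s)); [|lra].
rewrite Rinv_r by lra; nra.
Qed.

Lemma hdist_arg_ge_1 (w1 w2 : upper_half_plane) :
  1 <= 1 + Cmod (w1 - w2) ^ 2 / (2 * Im w1 * Im w2).
Proof.
pose proof (uhp_im_pos w1) as H1; pose proof (uhp_im_pos w2) as H2.
assert (0 <= Cmod (w1 - w2) ^ 2 / (2 * Im w1 * Im w2)); [|lra].
apply Rdiv_le_0_compat; [apply pow2_ge_0|nra].
Qed.

Lemma cosh_hdist (w1 w2 : upper_half_plane) :
  cosh (hdist w1 w2) = 1 + Cmod (w1 - w2) ^ 2 / (2 * Im w1 * Im w2).
Proof. apply cosh_arcosh, hdist_arg_ge_1. Qed.

Lemma hdist_pos (w1 w2 : upper_half_plane) : hdist w1 w2 >= 0.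
Proof. apply Rle_ge, arcosh_ge_0, hdist_arg_ge_1. Qed.

Lemma hdist_sym (w1 w2 : upper_half_plane) : hdist w1 w2 = hdist w2 w1.
Proof.
unfold hdist; f_equal.
rewrite <- (Cmod_opp (w1 - w2)), Copp_minus_distr.
replace (2 * Im w1 * Im w2) with (2 * Im w2 * Im w1) by ring; reflexivity.
Qed.

Lemma hdist_refl (w1 w2 : upper_half_plane) : hdist w1 w2 = 0 <-> w1 = w2.
Proof.
pose proof (uhp_im_pos w1) as H1; pose proof (uhp_im_pos w2) as H2.
split.
- intros H.
  pose proof (cosh_hdist w1 w2) as Hc; rewrite H, cosh_0 in Hc.
  assert (Hz : Cmod (w1 - w2) ^ 2 = 0).
  { replace (Cmod (w1 - w2) ^ 2)
      with (Cmod (w1 - w2) ^ 2 / (2 * Im w1 * Im w2) * (2 * Im w1 * Im w2))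
      by (field; lra).
    replace (Cmod (w1 - w2) ^ 2 / (2 * Im w1 * Im w2)) with 0 by lra; ring. }
  assert (Hm : Cmod (w1 - w2) = 0) by (apply Rsqr_0_uniq; unfold Rsqr; nra).
  apply Cmod_eq_0 in Hm.
  assert (Hw : uhp_val w1 = uhp_val w2).
  { replace (uhp_val w1) with ((w1 - w2) + w2)%C by ring.
    rewrite Hm; ring. }
  clear - Hw; destruct w1 as [w1 p1], w2 as [w2 p2]; simpl in Hw.
  subst w2; f_equal; apply proof_irrelevance.
- intros <-; unfold hdist, arcosh.
  replace (w1 - w1)%C with (RtoC 0) by ring.
  rewrite Cmod_0.
  replace (1 + 0 ^ 2 / (2 * Im w1 * Im w1)) with 1 by (field; lra).
  replace (1 ^ 2 - 1) with 0 by ring.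
  rewrite sqrt_0, Rplus_0_r; apply ln_1.
Qed.

Lemma cosh_double_sinh (x : R) : cosh x = 1 + 2 * sinh (x / 2) ^ 2.
Proof.
unfold cosh, sinh.
replace (exp x) with (exp (x / 2) * exp (x / 2))
  by (rewrite <- exp_plus; f_equal; lra).
replace (exp (- x)) with (exp (- (x / 2)) * exp (- (x / 2)))
  by (rewrite <- exp_plus; f_equal; lra).
assert (exp (x / 2) * exp (- (x / 2)) = 1)
  by (rewrite <- exp_plus, Rplus_opp_r; apply exp_0).
nra.
Qed.

Lemma cosh_sq (x : R) : cosh x ^ 2 = 1 + sinh x ^ 2.
Proof.
unfold cosh, sinh.
assert (exp x * exp (- x) = 1)
  by (rewrite <- exp_plus, Rplus_opp_r; apply exp_0).
nra.
Qed.

Lemma sinh_plus (x y : R) :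
  sinh (x + y) = sinh x * cosh y + cosh x * sinh y.
Proof.
unfold cosh, sinh; rewrite Ropp_plus_distr, !exp_plus; field.
Qed.

Lemma sinh_half_hdist (w1 w2 : upper_half_plane) :
  sinh (hdist w1 w2 / 2) =
    Cmod (w1 - w2) / (2 * (sqrt (Im w1) * sqrt (Im w2))).
Proof.
pose proof (uhp_im_pos w1) as H1; pose proof (uhp_im_pos w2) as H2.
pose proof (cosh_hdist w1 w2) as Hc; rewrite cosh_double_sinh in Hc.
pose proof (hdist_pos w1 w2) as Hd.
assert (Hs : 0 <= sinh (hdist w1 w2 / 2)).
{ destruct (Req_dec (hdist w1 w2) 0) as [->|Hn].
  - replace (0 / 2) with 0 by lra; rewrite sinh_0; lra.
  - rewrite <- sinh_0; apply Rlt_le, sinh_lt; lra. }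
pose proof (sqrt_lt_R0 _ H1) as R1; pose proof (sqrt_lt_R0 _ H2) as R2.
assert (0 <= Cmod (w1 - w2) / (2 * (sqrt (Im w1) * sqrt (Im w2))))
  by (apply Rdiv_le_0_compat; [apply Cmod_ge_0|nra]).
apply Rsqr_inj; trivial; unfold Rsqr.
rewrite <- (sqrt_sqrt (Im w1)), <- (sqrt_sqrt (Im w2)) in Hc by lra.
apply (Rmult_eq_reg_l 2); [|lra].
transitivity (Cmod (w1 - w2) ^ 2 /
  (2 * (sqrt (Im w1) * sqrt (Im w1)) * (sqrt (Im w2) * sqrt (Im w2)))).
- lra.
- field; lra.
Qed.

Lemma cosh_half_hdist (w1 w2 : upper_half_plane) :
  cosh (hdist w1 w2 / 2) =
    Cmod (w1 - Cconj w2) / (2 * (sqrt (Im w1) * sqrt (Im w2))).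
Proof.
pose proof (uhp_im_pos w1) as H1; pose proof (uhp_im_pos w2) as H2.
pose proof (sqrt_lt_R0 _ H1) as R1; pose proof (sqrt_lt_R0 _ H2) as R2.
assert (0 <= Cmod (w1 - Cconj w2) / (2 * (sqrt (Im w1) * sqrt (Im w2))))
  by (apply Rdiv_le_0_compat; [apply Cmod_ge_0|nra]).
assert (0 <= cosh (hdist w1 w2 / 2)).
{ unfold cosh; pose proof (exp_pos (hdist w1 w2 / 2)).
  pose proof (exp_pos (- (hdist w1 w2 / 2))); lra. }
apply Rsqr_inj; trivial; rewrite !Rsqr_pow2, cosh_sq, sinh_half_hdist.
unfold Rdiv; rewrite !Rpow_mult_distr, !Cmod2_alt.
assert (S1 := sqrt_sqrt (Im w1)); assert (S2 := sqrt_sqrt (Im w2)).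
replace (Re (w1 - Cconj w2)) with (Re w1 - Re w2) by (unfold Re, Im, Cconj; simpl; ring).
replace (Im (w1 - Cconj w2)) with (Im w1 + Im w2) by (unfold Re, Im, Cconj; simpl; ring).
replace (Re (w1 - w2)) with (Re w1 - Re w2) by (unfold Re, Im, Cconj; simpl; ring).
replace (Im (w1 - w2)) with (Im w1 - Im w2) by (unfold Re, Im, Cconj; simpl; ring).
replace ((Im w1 + Im w2) ^ 2)
  with ((Im w1 - Im w2) ^ 2 + 4 * (Im w1 * Im w2)) by ring.
set (t := (Im w1 - Im w2) ^ 2); clearbody t.
set (r1 := sqrt (Im w1)) in *; set (r2 := sqrt (Im w2)) in *.
rewrite <- S1, <- S2 by lra; field; lra.
Qed.

Lemma hdist_tri (w1 w2 w3 : upper_half_plane) :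
  hdist w1 w2 <= hdist w1 w3 + hdist w3 w2.
Proof.
apply Rnot_lt_le; intros Hlt.
assert (Hs : sinh (hdist w1 w3 / 2 + hdist w3 w2 / 2) < sinh (hdist w1 w2 / 2))
  by (apply sinh_lt; lra).
revert Hs; apply Rle_not_lt.
rewrite sinh_plus, (hdist_sym w3 w2), !sinh_half_hdist, !cosh_half_hdist.
pose proof (uhp_im_pos w1) as H1; pose proof (uhp_im_pos w2) as H2.
pose proof (uhp_im_pos w3) as H3.
pose proof (sqrt_lt_R0 _ H1) as R1; pose proof (sqrt_lt_R0 _ H2) as R2.
pose proof (sqrt_lt_R0 _ H3) as R3.
(* Ptolemy's inequality for w1, w2, w3 and the conjugate of w3 *)
assert (P : Cmod (w1 - w2) * (2 * Im w3) <=
  Cmod (w1 - w3) * Cmod (w2 - Cconj w3) +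
  Cmod (w1 - Cconj w3) * Cmod (w2 - w3)).
{ replace (2 * Im w3) with (Cmod (w3 - Cconj w3)).
  2:{ rewrite im_alt', !Cmod_mult, Cmod_Ci, !Cmod_R, !Rabs_pos_eq by lra.
      ring. }
  rewrite <- !Cmod_mult, <- (Cmod_opp ((w1 - Cconj w3) * (w2 - w3))).
  replace ((w1 - w2) * (w3 - Cconj w3))%C
    with ((w1 - w3) * (w2 - Cconj w3) + - ((w1 - Cconj w3) * (w2 - w3)))%C
    by ring.
  apply Cmod_triangle. }
rewrite <- (sqrt_sqrt (Im w3)) in P by lra.
set (r1 := sqrt (Im w1)) in *; set (r2 := sqrt (Im w2)) in *.
set (r3 := sqrt (Im w3)) in *.
apply (Rmult_le_reg_r (4 * (r1 * r2) * (r3 * r3))).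
{ repeat apply Rmult_lt_0_compat; lra. }
match goal with |- ?L <= ?U =>
  replace L with (Cmod (w1 - w2) * (2 * (r3 * r3))) by (field; lra);
  replace U with (Cmod (w1 - w3) * Cmod (w2 - Cconj w3) +
    Cmod (w1 - Cconj w3) * Cmod (w2 - w3)) by (field; lra) end.
exact P.
Qed.

Definition hyperbolic_plane : Metric_Space :=
  Build_Metric_Space upper_half_plane hdist
    hdist_pos hdist_sym hdist_refl hdist_tri.

(* Main.v *)
Require Import Defs.
From Stdlib Require Import Reals Lra.
From Coquelicot Require Import Coquelicot.
Open Scope R_scope.

(** Write [d] for the hyperbolic distance.

    The upper bound comes from a Ptolemy inequality for [exp (d / 2)]:
    for all points of the plane,
    [exp ((d x y + d z t) / 2) <= exp ((d x z + d y t) / 2)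
                                  + exp ((d x t + d y z) / 2)]
    ([exp_half_hdist_ptolemy]).  The right-hand side is at most twice its larger
    term, so taking logarithms gives the four-point condition with an additive
    error [ln 2] on half sums of distances, that is on Gromov products
    ([gromov_hyperbolic_of_exp_ptolemy]).  To obtain the inequality, add the
    formulas for [sinh (d / 2)] and [cosh (d / 2)]: up to factors that are the
    same in all three terms, [exp (d w1 w2 / 2)] is [|w1 - w2| + |w1 - w2*|],
    where the star is complex conjugation.  After expanding, everything reduces
    to the Euclidean Ptolemy inequality for the four points, some of them
    replaced by their conjugates ([Cmod_sum_conj_ptolemy]).

    For optimality, consider a regular quadrilateral whose vertices tend to
    infinity.  If [c] is the hyperbolic cosine of its side [s], that of its
    diagonal [D] is [2 * c - 1]: by Pythagoras' theorem at the centre, [c] is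
    the square of [cosh (D / 2)].  Since [2 * cosh r - 1 <= exp r <= 2 * cosh r]
    for [r >= 0], this yields [exp (D - s) >= (4 * c - 3) / (2 * c)], which
    tends to [2].  Hyperbolicity applied to the vertices says precisely that
    [D - s <= delta]. *)

(** * Ptolemy inequalities *)

(** The triangle inequality for the identity
    [(p - q) (r - s) = (p - r) (q - s) - (p - s) (q - r)]. *)
Lemma Cmod_ptolemy (p q r s : C) :
  Cmod (p - q) * Cmod (r - s) <=
    Cmod (p - r) * Cmod (q - s) + Cmod (p - s) * Cmod (q - r).
Proof.
rewrite <- !Cmod_mult, <- (Cmod_opp ((p - s) * (q - r))).
replace ((p - q) * (r - s))%C
  with ((p - r) * (q - s) + - ((p - s) * (q - r)))%C by ring.
apply Cmod_triangle.
Qed.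

Lemma Cmod_minus_conj_conj (p q : C) :
  Cmod (Cconj p - Cconj q) = Cmod (p - q).
Proof. rewrite <- Cminus_conj; apply Cmod_conj. Qed.

Lemma Cmod_conj_minus (p q : C) : Cmod (Cconj p - q) = Cmod (p - Cconj q).
Proof. rewrite <- (Cmod_minus_conj_conj p), Cconj_conj; reflexivity. Qed.

Lemma Cmod_minus_le_conj (p q : C) :
  0 <= Im p -> 0 <= Im q -> Cmod (p - q) <= Cmod (p - Cconj q).
Proof.
intros Hp Hq.
apply Rsqr_incr_0; try apply Cmod_ge_0.
rewrite !Rsqr_pow2, !Cmod2_alt.
destruct p as [a b], q as [c d]; unfold Re, Im, Cconj in *; simpl in *; nra.
Qed.

(** Each of the four products on the left is bounded by Ptolemy's inequality
    for the four points, some of them replaced by their conjugates, which can be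
    done in two ways.  The bounds should use up the eight products on the right,
    but no choice of them uses each exactly once.  Two facts make up for this:
    in the upper half-plane a distance only grows when one of the two points is
    conjugated, and for the mixed terms [|x - y| |z - t*|] and
    [|x - y*| |z - t|] there are two pairs of bounds that differ from the wanted
    one by repeating one product instead of using another; one of these pairs
    repeats the smaller product. *)
Lemma Cmod_sum_conj_ptolemy (x y z t : C) :
  0 <= Im x -> 0 <= Im y -> 0 <= Im z -> 0 <= Im t ->
  (Cmod (x - y) + Cmod (x - Cconj y)) * (Cmod (z - t) + Cmod (z - Cconj t)) <=
    (Cmod (x - z) + Cmod (x - Cconj z)) * (Cmod (y - t) + Cmod (y - Cconj t)) +
    (Cmod (x - t) + Cmod (x - Cconj t)) * (Cmod (y - z) + Cmod (y - Cconj z)).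
Proof.
intros Hx Hy Hz Ht.
assert (LAB : Cmod (x - z) * Cmod (y - t) <=
  Cmod (x - Cconj z) * Cmod (y - Cconj t)).
{ apply Rmult_le_compat; try apply Cmod_ge_0; apply Cmod_minus_le_conj; trivial. }
pose proof (Cmod_ptolemy x y z t) as P.
pose proof (Cmod_ptolemy x (Cconj y) z (Cconj t)) as Pyt.
pose proof (Cmod_ptolemy x y z (Cconj t)) as Pt.
pose proof (Cmod_ptolemy x y (Cconj z) t) as Pz.
pose proof (Cmod_ptolemy x (Cconj y) z t) as Py.
pose proof (Cmod_ptolemy x (Cconj y) (Cconj z) (Cconj t)) as Pyzt.
rewrite Cmod_minus_conj_conj, Cmod_conj_minus in Pyt.
rewrite Cmod_conj_minus in Pz.
rewrite !Cmod_conj_minus in Py.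
rewrite !Cmod_minus_conj_conj in Pyzt.
(* The mixed terms are bounded by [Pz] and [Py] in the first case and by [Pt]
   and [Pyzt] in the second: each pair repeats the smaller product. *)
destruct (Rle_or_lt (Cmod (x - t) * Cmod (y - Cconj z))
  (Cmod (x - Cconj t) * Cmod (y - z))); lra.
Qed.

Lemma exp_half_hdist (w1 w2 : upper_half_plane) :
  exp (hdist w1 w2 / 2) =
    (Cmod (w1 - w2) + Cmod (w1 - Cconj w2)) /
    (2 * (sqrt (Im w1) * sqrt (Im w2))).
Proof.
rewrite Rdiv_plus_distr, <- sinh_half_hdist, <- cosh_half_hdist.
unfold sinh, cosh; field.
Qed.

Lemma exp_half_hdist_ptolemy (x y z t : upper_half_plane) :
  exp ((hdist x y + hdist z t) / 2) <=
    exp ((hdist x z + hdist y t) / 2) + exp ((hdist x t + hdist y z) / 2).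
Proof.
rewrite !Rdiv_plus_distr, !exp_plus, !exp_half_hdist.
pose proof (uhp_im_pos x) as Hx; pose proof (uhp_im_pos y) as Hy.
pose proof (uhp_im_pos z) as Hz; pose proof (uhp_im_pos t) as Ht.
pose proof (sqrt_lt_R0 _ Hx); pose proof (sqrt_lt_R0 _ Hy).
pose proof (sqrt_lt_R0 _ Hz); pose proof (sqrt_lt_R0 _ Ht).
pose proof (Cmod_sum_conj_ptolemy x y z t) as P.
set (a := sqrt (Im x)) in *; set (b := sqrt (Im y)) in *.
set (c := sqrt (Im z)) in *; set (d := sqrt (Im t)) in *.
apply (Rmult_le_reg_r (4 * (a * b * c * d))).
{ repeat apply Rmult_lt_0_compat; lra. }
match type of P with _ -> _ -> _ -> _ -> ?L <= ?U =>
  match goal with |- ?l <= ?u =>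
    replace l with L by (field; lra); replace u with U by (field; lra)
  end end.
apply P; lra.
Qed.

(** * From a Ptolemy inequality to hyperbolicity *)

Lemma exp_le (x y : R) : x <= y -> exp x <= exp y.
Proof.
intros [H|H]; [apply Rlt_le, exp_increasing, H|rewrite H; apply Rle_refl].
Qed.

Lemma exp_le_inv (x y : R) : exp x <= exp y -> x <= y.
Proof. intros [H|H]; [apply Rlt_le, exp_lt_inv, H|apply Req_le, exp_inv, H]. Qed.

Lemma gromov_hyperbolic_of_exp_ptolemy (X : Metric_Space) :
  (forall x y z t : Base X,
     exp ((dist X x y + dist X z t) / 2) <=
       exp ((dist X x z + dist X y t) / 2) +
       exp ((dist X x t + dist X y z) / 2)) ->
  gromov_hyperbolic (ln 2) X.
Proof.
intros HX x y z o; specialize (HX x y z o).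
unfold gromov_product.
set (p := (dist X x y + dist X z o) / 2) in *.
set (q := (dist X x z + dist X y o) / 2) in *.
set (r := (dist X x o + dist X y z) / 2) in *.
(* The larger of [q] and [r] corresponds to the smaller Gromov product. *)
destruct (Rle_or_lt q r) as [Hqr|Hqr].
- pose proof (Rmin_r ((dist X x o + dist X z o - dist X x z) / 2)
    ((dist X y o + dist X z o - dist X y z) / 2)).
  enough (p <= ln 2 + r) by (unfold p, r in *; lra).
  apply exp_le_inv; rewrite exp_plus, exp_ln by lra.
  pose proof (exp_le q r Hqr); lra.
- pose proof (Rmin_l ((dist X x o + dist X z o - dist X x z) / 2)
    ((dist X y o + dist X z o - dist X y z) / 2)).
  enough (p <= ln 2 + q) by (unfold p, q in *; lra).
  apply exp_le_inv; rewrite exp_plus, exp_ln by lra.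
  pose proof (exp_increasing r q Hqr); lra.
Qed.

(** * A family of regular quadrilaterals *)

Lemma exp_bounds_cosh (r : R) :
  0 <= r -> 2 * cosh r - 1 <= exp r <= 2 * cosh r.
Proof.
intros Hr; unfold cosh.
pose proof (exp_pos (- r)).
assert (exp (- r) <= 1) by (rewrite <- exp_0; apply exp_le; lra).
lra.
Qed.

Lemma eq_hdist_of_cosh (a b a' b' : upper_half_plane) :
  cosh (hdist a b) = cosh (hdist a' b') -> hdist a b = hdist a' b'.
Proof.
rewrite !cosh_hdist; intros H; unfold hdist; rewrite H; reflexivity.
Qed.

(** The vertices [i u], [i / u] are symmetric about the centre [i], and so are
    the other two, which the quarter turn about [i] exchanges with them; the
    four are the images of [r], [- r], [i r], [- i r] in the unit disc, for
    [r = (u - 1) / (u + 1)]. *)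
Lemma regular_quadrilateral (u : R) :
  0 < u ->
  let c := ((u + / u) / 2) ^ 2 in
  exists x y z t : upper_half_plane,
    (cosh (hdist x y) = 2 * c - 1 /\ cosh (hdist z t) = 2 * c - 1) /\
    (cosh (hdist x z) = c /\ cosh (hdist y z) = c /\
     cosh (hdist x t) = c /\ cosh (hdist y t) = c).
Proof.
intros Hu c.
assert (Hv : 0 < / u) by (apply Rinv_0_lt_compat, Hu).
assert (Hn : 0 < u ^ 2 + 1) by nra.
assert (Hb : 0 < 2 * u / (u ^ 2 + 1)) by (apply Rdiv_lt_0_compat; lra).
exists (UHP (0, u) Hu), (UHP (0, / u) Hv),
  (UHP ((u ^ 2 - 1) / (u ^ 2 + 1), 2 * u / (u ^ 2 + 1)) Hb),
  (UHP (- ((u ^ 2 - 1) / (u ^ 2 + 1)), 2 * u / (u ^ 2 + 1)) Hb).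
unfold c.
repeat split; rewrite cosh_hdist, Cmod2_alt; unfold Re, Im; simpl; field; lra.
Qed.

Lemma gromov_hyperbolic_plane_lower_bound (delta u : R) :
  gromov_hyperbolic delta hyperbolic_plane -> 0 < u ->
  let c := ((u + / u) / 2) ^ 2 in 4 * c - 3 <= 2 * c * exp delta.
Proof.
intros H Hu c.
destruct (regular_quadrilateral u Hu) as (x & y & z & t & (Hxy & Hzt) & Hs).
fold c in Hxy, Hzt, Hs; destruct Hs as (Hxz & Hyz & Hxt & Hyt).
specialize (H x y z t); unfold gromov_product in H; simpl in H.
rewrite (eq_hdist_of_cosh z t x y), (eq_hdist_of_cosh y z x z),
  (eq_hdist_of_cosh x t x z), (eq_hdist_of_cosh y t x z) in H by congruence.
rewrite Rmin_left in H by lra.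
pose proof (exp_bounds_cosh _ (Rge_le _ _ (hdist_pos x y))) as BD.
pose proof (exp_bounds_cosh _ (Rge_le _ _ (hdist_pos x z))) as BS.
rewrite Hxy in BD; rewrite Hxz in BS.
apply Rle_trans with (exp (hdist x z + delta)).
- apply Rle_trans with (exp (hdist x y)); [lra|apply exp_le; lra].
- rewrite exp_plus; apply Rmult_le_compat_r; [apply Rlt_le, exp_pos|lra].
Qed.

Theorem corollary5p4 :
  gromov_hyperbolic (ln 2) hyperbolic_plane /\
  (forall delta : R, 0 <= delta ->
     gromov_hyperbolic delta hyperbolic_plane -> ln 2 <= delta).
Proof.
split.
- apply gromov_hyperbolic_of_exp_ptolemy, exp_half_hdist_ptolemy.
- intros delta Hdelta H.
  apply exp_le_inv; rewrite exp_ln by lra.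
  apply Rnot_lt_le; intros Hlt.
  assert (H1 : 1 <= exp delta) by (rewrite <- exp_0; apply exp_le, Hdelta).
  set (k := 2 - exp delta).
  (* The lower bound reads [2 * c * k <= 3], whereas [c >= u ^ 2 / 4] and
     [k <= 1]; any [u] with [u ^ 2 * k > 6] is a contradiction. *)
  assert (Hu : 3 <= 3 / k).
  { apply Rle_div_r; unfold k; lra. }
  assert (Hk : 3 / k * k = 3) by (unfold k; field; lra).
  pose proof (gromov_hyperbolic_plane_lower_bound delta (3 / k) H) as B.
  cbv zeta in B; specialize (B ltac:(lra)).
  assert (Hi : 0 < / (3 / k)) by (apply Rinv_0_lt_compat; lra).
  replace (exp delta) with (2 - k) in B by (unfold k; ring).
  set (u := 3 / k) in *; set (v := / u) in *.
  assert (Hc : u ^ 2 / 4 <= ((u + v) / 2) ^ 2) by nra.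
  assert (0 < k) by (unfold k; lra).
  nra.
Qed.
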